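(* Let $(\mathtt{s},\mathtt{e})$ be a prepare-and-measure scenario with reduced space $\mathcal{R}$. Then $(\mathtt{s},\mathtt{e})$ admits a Riemann integrable operationally noncontextual ontological model if and only if $$\mathbb{J}(\mathbb{1}_{\mathcal{R}})\in \mathtt{Sep}(\mathtt{s},\mathtt{e}).$$
   Context: Scenario. $\mathcal{H}$ is a finite-dimensional complex Hilbert space; $\mathcal{L}(\mathcal{H})$ is the real vector space of Hermitian operators on $\mathcal{H}$ with inner product $\langle a,b\rangle_{\mathcal{L}(\mathcal{H})}=\mathrm{Tr}[ab]$. A state space $\mathtt{s}$ is a nonempty convex set of density matrices on $\mathcal{H}$. An effect space $\mathtt{e}$ is a convex set of effects (Hermitian $E$ with $E\ge 0$ and $\mathbb{1}_{\mathcal{H}}-E\ge 0$) such that $0_{\mathcal{H}},\mathbb{1}_{\mathcal{H}}\in\mathtt{e}$ and for every $E\in\mathtt{e}$ there is a (finite or countable) family $\{E_k\in\mathtt{e}\}_k$ with $E+\sum_kE_k=\mathbb{1}_{\mathcal{H}}$. The pair $(\mathtt{s},\mathtt{e})$ is a prepare-and-measure scenario. $P_{\mathcal{V}}$ denotes orthogonal projection onto a subspace $\mathcal{V}\subseteq\mathcal{L}(\mathcal{H})$, and $P_{\mathcal V}(X)=\{P_{\mathcal V}(x):x\in X\}$. The reduced space is $\mathcal{R}:=P_{\mathrm{span}(\mathtt{e})}(\mathrm{span}(\mathtt{s}))\subseteq\mathcal{L}(\mathcal{H})$, a vector space with inherited inner product $\langle\cdot,\cdot\rangle_{\mathcal{R}}$.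 Model. An operationally noncontextual ontological model for $(\mathtt{s},\mathtt{e})$ with ontic space $\Lambda$ (a set with a fixed positive measure $\mathrm{d}\lambda$; for discrete $\Lambda$ integrals are sums) is a pair of maps $\mu:P_{\mathcal{R}}(\mathtt{s})\times\Lambda\to\mathbb{R}$, $\xi:P_{\mathcal{R}}(\mathtt{e})\times\Lambda\to\mathbb{R}$ such that: (a) $\int_\Lambda\mathrm{d}\lambda\,\mu(\bar\rho,\lambda)=1$ for all $\bar\rho\in P_{\mathcal{R}}(\mathtt{s})$; (b) $\mu\ge0$; (c) for each $\lambda$, $\mu(p\bar\rho_1+(1-p)\bar\rho_2,\lambda)=p\mu(\bar\rho_1,\lambda)+(1-p)\mu(\bar\rho_2,\lambda)$ for all $p\in[0,1]$, $\bar\rho_1,\bar\rho_2\in P_{\mathcal{R}}(\mathtt{s})$; (d) for each $\lambda$, each $K\in\mathbb{N}\cup\{+\infty\}$ and each family $\{E_k\in\mathtt{e}\}_{k=1}^K$ with $\sum_{k=1}^KE_k=\mathbb{1}_{\mathcal{H}}$, $\sum_{k=1}^K\xi(P_{\mathcal{R}}(E_k),\lambda)=1$; (e) $\xi\ge0$; (f) for each $\lambda$, $\xi(p\bar E_1+(1-p)\bar E_2,\lambda)=p\xi(\bar E_1,\lambda)+(1-p)\xi(\bar E_2,\lambda)$ for all $p\in[0,1]$, $\bar E_1,\bar E_2\in P_{\mathcal{R}}(\mathtt{e})$; (g) $\langle\bar\rho,\bar E\rangle_{\mathcal{R}}=\int_\Lambda\mathrm{d}\lambda\,\mu(\bar\rho,\lambda)\xi(\bar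 E,\lambda)$ for all $\bar\rho\in P_{\mathcal{R}}(\mathtt{s})$, $\bar E\in P_{\mathcal{R}}(\mathtt{e})$. The model is Riemann integrable if there exist $\Delta:\mathbb{N}\times\mathbb{N}\to\mathbb{R}_{\ge0}$ and $\lambda^{(\mathrm{dis})}:\mathbb{N}\times\mathbb{N}\to\Lambda$ such that for all $\bar\rho\in P_{\mathcal{R}}(\mathtt{s})$, $\bar E\in P_{\mathcal{R}}(\mathtt{e})$, $$\int_\Lambda\mathrm{d}\lambda\,\mu(\bar\rho,\lambda)\xi(\bar E,\lambda)=\lim_{N\to\infty}\sum_{k=1}^N\Delta_{N,k}\,\mu(\bar\rho,\lambda^{(\mathrm{dis})}_{N,k})\,\xi(\bar E,\lambda^{(\mathrm{dis})}_{N,k}).$$ Separability. For a finite-dimensional real inner product space $\mathcal{V}$ and $X\subseteq\mathcal{V}$, the polar cone is $X^{+_{\mathcal{V}}}:=\{y\in\mathcal{V}:\langle x,y\rangle_{\mathcal{V}}\ge0\ \forall x\in X\}$. $\mathcal{R}\otimes\mathcal{R}$ carries the inner product with $\langle a\otimes b,x\otimes y\rangle=\langle a,x\rangle_{\mathcal{R}}\langle b,y\rangle_{\mathcal{R}}$. Define $\mathtt{Sep}(\mathtt{s},\mathtt{e}):=\mathrm{conv}\{F\otimes\sigma: F\in P_{\mathcal{R}}(\mathtt{s})^{+_{\mathcal{R}}},\ \sigma\in P_{\mathcal{R}}(\mathtt{e})^{+_{\mathcal{R}}}\}$ (finite convex combinations). For a linear map $\Phi:\mathcal{R}\to\mathcal{R}$,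 $\mathbb{J}(\Phi)\in\mathcal{R}\otimes\mathcal{R}$ is the unique element with $\langle r,\Phi(s)\rangle_{\mathcal{R}}=\langle\mathbb{J}(\Phi),r\otimes s\rangle_{\mathcal{R}\otimes\mathcal{R}}$ for all $r,s\in\mathcal{R}$; $\mathbb{1}_{\mathcal{R}}$ is the identity map on $\mathcal{R}$. *)

(* Defs.v *)
From mathcomp Require Import all_boot all_order all_algebra.
From mathcomp Require Export complex mxtens.
From mathcomp Require Import all_classical all_reals all_analysis.

Set Implicit Arguments.
Unset Strict Implicit.
Unset Printing Implicit Defensive.

Import Order.TTheory GRing.Theory Num.Theory.
Import numFieldNormedType.Exports.

Local Open Scope classical_set_scope.
Local Open Scope complex_scope.
Local Open Scope ring_scope.

(* The Hilbert space is C^n with C = R[i]; Hermitian operators are complex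
   matrices, and L(C^n) is handled as a real subspace of 'M[R[i]]_n: all linear
   combinations below have coefficients c%:C with c : R. *)

Section Hermitian.
Context {R : realType}.

Definition adjmx m n (A : 'M[R[i]]_(m, n)) : 'M[R[i]]_(n, m) :=
  map_mx Num.conj A^T.

(* On R[i], 0 <= z means that z is real and nonnegative. *)
Definition psdmx n (A : 'M[R[i]]_n) : Prop :=
  A \is hermsymmx /\
  forall v : 'cV[R[i]]_n, 0 <= (adjmx v *m A *m v) ord0 ord0.

Definition density_matrix n (A : 'M[R[i]]_n) : Prop :=
  psdmx A /\ \tr A = 1.

Definition effect n (A : 'M[R[i]]_n) : Prop :=
  psdmx A /\ psdmx (1%:M - A).

(* Tr[ab]; the trace is already real when a and b are Hermitian. *)
Definition hsip n (a b : 'M[R[i]]_n) : R := complex.Re (\tr (a *m b)).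

Definition hsnorm n (a : 'M[R[i]]_n) : R := Num.sqrt (hsip a a).

(* \sum_(k < oo) E k = S, convergence being taken in the norm of L(C^n). *)
Definition hs_series_to n (E : nat -> 'M[R[i]]_n) (S : 'M[R[i]]_n) : Prop :=
  (fun N => hsnorm (series E N - S)) @ \oo --> (0 : R).

Definition rspan n (X : set 'M[R[i]]_n) : set 'M[R[i]]_n :=
  [set x | exists (m : nat) (c : 'I_m -> R) (v : 'I_m -> 'M[R[i]]_n),
    (forall i, X (v i)) /\ x = \sum_i (c i)%:C *: v i].

Definition conv_hull n (X : set 'M[R[i]]_n) : set 'M[R[i]]_n :=
  [set x | exists (m : nat) (p : 'I_m -> R) (v : 'I_m -> 'M[R[i]]_n),
    [/\ forall i, 0 <= p i, \sum_i p i = 1, forall i, X (v i)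
      & x = \sum_i (p i)%:C *: v i]].

(* Orthogonal projection of a Hermitian x onto a real subspace V of Hermitian
   matrices: the unique y in V with x - y orthogonal to V. *)
Definition orthproj n (V : set 'M[R[i]]_n) (x : 'M[R[i]]_n) : 'M[R[i]]_n :=
  xget 0 [set y | V y /\ forall v, V v -> hsip (x - y) v = 0].

Definition polar_cone n (V X : set 'M[R[i]]_n) : set 'M[R[i]]_n :=
  [set y | V y /\ forall x, X x -> 0 <= hsip x y].

(* V (x) V inside L(C^n (x) C^n) through the Kronecker product; by hsip_tens
   below, hsip on 'M_(n * n) restricts to its tensor inner product. *)
Definition tens_space n (V : set 'M[R[i]]_n) : set 'M[R[i]]_(n * n) :=
  rspan [set a *t b | a in V & b in V].

(* The unique J in V (x) V representing the bilinear form <r, Phi s> of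
   Phi : V -> V; only the values of Phi on V matter. *)
Definition choi n (V : set 'M[R[i]]_n) (Phi : 'M[R[i]]_n -> 'M[R[i]]_n) :
    'M[R[i]]_(n * n) :=
  xget 0 [set J | tens_space V J /\
    forall r s, V r -> V s -> hsip r (Phi s) = hsip J (r *t s)].

Lemma mxtrace_tens n p (A : 'M[R[i]]_n) (B : 'M[R[i]]_p) :
  \tr (A *t B) = \tr A * \tr B.
Proof.
rewrite /mxtrace big_distrl /=.
under [RHS]eq_bigr do rewrite big_distrr /=.
rewrite pair_big /= (reindex (@mxtens_index n p)) /=; last first.
  by exists (@mxtens_unindex n p) => ? _; rewrite ?mxtens_indexK ?mxtens_unindexK.
by apply: eq_bigr => -[i j] _; rewrite tensmxE.
Qed.

Lemma hermE n (A : 'M[R[i]]_n) : A \is hermsymmx -> A = adjmx A.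
Proof. by move=> /is_hermitianmxP; rewrite expr0 scale1r. Qed.

Lemma mxtrace_herm_real n (A B : 'M[R[i]]_n) :
  A \is hermsymmx -> B \is hermsymmx -> \tr (A *m B) \is Num.real.
Proof.
move=> /hermE hA /hermE hB; rewrite CrealE; apply/eqP.
rewrite -[LHS]/(Num.conj _) -trace_map_mx map_mxM -mxtrace_tr trmx_mul.
by rewrite !map_trmx -/(adjmx A) -/(adjmx B) -hA -hB mxtrace_mulC.
Qed.

Lemma hsip_tens n (a b x y : 'M[R[i]]_n) :
  a \is hermsymmx -> b \is hermsymmx ->
  x \is hermsymmx -> y \is hermsymmx ->
  hsip (a *t b) (x *t y) = hsip a x * hsip b y.
Proof.
move=> ha hb hx hy; rewrite /hsip tensmx_mul mxtrace_tens.
have /complex_realP[p ->] := mxtrace_herm_real ha hx.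
by have /complex_realP[q ->] := mxtrace_herm_real hb hy; rewrite /= mulr0 subr0.
Qed.

End Hermitian.

Section Scenario.
Context {R : realType} {n : nat}.
Implicit Types (s e : set 'M[R[i]]_n).

(* convex_set is taken over the scalars R[i], but the weights, being elements
   of [0, 1] in the order of R[i], are real. *)
Lemma convex_setP (X : set 'M[R[i]]_n) : convex_set X <->
  forall (p : R) x y, 0 <= p <= 1 -> X x -> X y ->
    X (p%:C *: x + (1 - p)%:C *: y).
Proof.
split=> [cX p x y /andP[p0 p1] Xx Xy|cX x y l].
  have pC0 : (0 : R[i]) <= p%:C by rewrite lecE /= eqxx.
  have pC1 : p%:C <= (1 : R[i]) by rewrite lecE /= eqxx.
  have := cX x y (Itv01 pC0 pC1) (mem_set Xx) (mem_set Xy).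
  by rewrite inE /conv /= rmorphB rmorph1.
rewrite !inE => Xx Xy.
have l0 : 0 <= l%:num by []. have l1 : l%:num <= 1 by [].
have /complex_realP[p lp] : l%:num \is Num.real by [].
move: l0 l1; rewrite lp !lecE /= eqxx /= => l0 l1.
have := cX p x y; rewrite l0 l1 => /(_ isT Xx Xy).
by rewrite rmorphB rmorph1 /= -lp.
Qed.

Definition state_space s : Prop :=
  [/\ s !=set0, convex_set s & forall rho, s rho -> density_matrix rho].

Definition effect_space e : Prop :=
  [/\ convex_set e, (forall E, e E -> effect E), e 0, e 1%:M
    & forall E, e E ->
      (exists (K : nat) (F : 'I_K -> 'M[R[i]]_n),
        (forall k, e (F k)) /\ E + \sum_k F k = 1%:M) \/
      (exists F : nat -> 'M[R[i]]_n,
        (forall k, e (F k)) /\ hs_series_to F (1%:M - E))].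

Definition reduced_space s e : set 'M[R[i]]_n :=
  orthproj (rspan e) @` rspan s.

Definition redproj s e : 'M[R[i]]_n -> 'M[R[i]]_n :=
  orthproj (reduced_space s e).

Definition Sep s e : set 'M[R[i]]_(n * n) :=
  let V := reduced_space s e in
  conv_hull [set F *t sigma | F in polar_cone V (redproj s e @` s)
                            & sigma in polar_cone V (redproj s e @` e)].

(* The response functions mu and xi are total functions whose values outside
   of redproj s e @` s and redproj s e @` e are irrelevant.  The integrability
   fields state that the integrals in nc_mu1 and nc_born exist, since the
   library integral is total. *)
Record noncontextual_model s e d (L : measurableType d)
    (nu : {measure set L -> \bar R}) (mu xi : 'M[R[i]]_n -> L -> R) : Prop := {
  nc_mu_integrable : forall r, (redproj s e @` s) r ->
    nu.-integrable setT (fun l => (mu r l)%:E) ;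
  nc_mu1 : forall r, (redproj s e @` s) r -> \int[nu]_l mu r l = 1 ;
  nc_mu_ge0 : forall r l, (redproj s e @` s) r -> 0 <= mu r l ;
  nc_mu_conv : forall l (p : R) r1 r2, 0 <= p <= 1 ->
    (redproj s e @` s) r1 -> (redproj s e @` s) r2 ->
    mu (p%:C *: r1 + (1 - p)%:C *: r2) l = p * mu r1 l + (1 - p) * mu r2 l ;
  nc_xi_fin : forall l (K : nat) (E : 'I_K -> 'M[R[i]]_n),
    (forall k, e (E k)) -> \sum_k E k = 1%:M ->
    \sum_k xi (redproj s e (E k)) l = 1 ;
  nc_xi_inf : forall l (E : nat -> 'M[R[i]]_n),
    (forall k, e (E k)) -> hs_series_to E 1%:M ->
    series (fun k => xi (redproj s e (E k)) l) @ \oo --> (1 : R) ;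
  nc_xi_ge0 : forall E l, (redproj s e @` e) E -> 0 <= xi E l ;
  nc_xi_conv : forall l (p : R) E1 E2, 0 <= p <= 1 ->
    (redproj s e @` e) E1 -> (redproj s e @` e) E2 ->
    xi (p%:C *: E1 + (1 - p)%:C *: E2) l = p * xi E1 l + (1 - p) * xi E2 l ;
  nc_born_integrable : forall r E,
    (redproj s e @` s) r -> (redproj s e @` e) E ->
    nu.-integrable setT (fun l => (mu r l * xi E l)%:E) ;
  nc_born : forall r E, (redproj s e @` s) r -> (redproj s e @` e) E ->
    hsip r E = \int[nu]_l (mu r l * xi E l) }.

Definition riemann_integrable s e d (L : measurableType d)
    (nu : {measure set L -> \bar R}) (mu xi : 'M[R[i]]_n -> L -> R) : Prop :=
  exists (Delta : nat -> nat -> R) (ldis : nat -> nat -> L),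
    (forall N k, 0 <= Delta N k) /\
    forall r E, (redproj s e @` s) r -> (redproj s e @` e) E ->
      (fun N => \sum_(1 <= k < N.+1)
        Delta N k * mu r (ldis N k) * xi E (ldis N k)) @ \oo -->
      \int[nu]_l (mu r l * xi E l).

End Scenario.

(* Main.v *)
(* If J(1) = \sum_i p_i F_i (x) sigma_i, the index i is the ontic state, with
   mu(r, i) = p_i <F_i, r> <sigma_i, 1> and xi(E, i) = <sigma_i, E> / <sigma_i, 1>.
   Conversely, at each ontic state mu and xi are affine on the projected states
   and effects (with xi(0) = 0), hence restrictions of linear functionals F and
   sigma on the reduced space, so the Riemann sums express J(1) as a limit of sums of
   elements F (x) sigma.  It remains to see that such sums form a closed set.  In
   coordinates dual to a basis of projected states, resp. effects, the F and sigma
   are nonnegative vectors; by Caratheodory the number of terms may be kept fixed,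
   each nonnegative term is bounded by the total, and after normalizing F both
   factors stay bounded, so they converge along an ultrafilter. *)
Require Import Defs.
From mathcomp Require Import all_boot all_order all_algebra.
From mathcomp Require Import complex mxtens.
From mathcomp Require Import all_classical all_reals all_analysis.
From mathcomp Require Import ring lra.

Set Implicit Arguments.
Unset Strict Implicit.
Unset Printing Implicit Defensive.

Import Order.TTheory GRing.Theory Num.Theory.
Import numFieldNormedType.Exports.

Local Open Scope classical_set_scope.
Local Open Scope complex_scope.
Local Open Scope ring_scope.

(** * The trace inner product on Hermitian matrices *)

Section HilbertSchmidt.
Context {R : realType}.

Lemma Re_sum (I : Type) (r : seq I) (P : pred I) (F : I -> R[i]) :
  complex.Re (\sum_(i <- r | P i) F i) = \sum_(i <- r | P i) complex.Re (F i).
Proof. by apply: (big_morph (@complex.Re R)) => // -[a b] [c d]. Qed.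

Section Fixed.
Context {n : nat}.
Implicit Types (a b x y : 'M[R[i]]_n) (c : R).

Lemma hsipC a b : hsip a b = hsip b a.
Proof. by rewrite /hsip mxtrace_mulC. Qed.

Lemma hsipDl a b x : hsip (a + b) x = hsip a x + hsip b x.
Proof. by rewrite /hsip mulmxDl mxtraceD raddfD. Qed.

Lemma hsipZl c a x : hsip (c%:C *: a) x = c * hsip a x.
Proof.
by rewrite /hsip -scalemxAl mxtraceZ; case: (\tr _) => p q /=; rewrite mul0r subr0.
Qed.

Lemma hsip0l x : hsip 0 x = 0.
Proof. by rewrite /hsip mul0mx mxtrace0. Qed.

Lemma hsipNl a x : hsip (- a) x = - hsip a x.
Proof. by rewrite /hsip mulNmx raddfN raddfN. Qed.

Lemma hsipBl a b x : hsip (a - b) x = hsip a x - hsip b x.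
Proof. by rewrite hsipDl hsipNl. Qed.

Lemma hsip_suml (I : Type) (r : seq I) (P : pred I) (F : I -> 'M[R[i]]_n) x :
  hsip (\sum_(i <- r | P i) F i) x = \sum_(i <- r | P i) hsip (F i) x.
Proof. exact: (big_morph _ (fun a b => hsipDl a b x) (hsip0l x)). Qed.

Lemma hsipDr a b x : hsip x (a + b) = hsip x a + hsip x b.
Proof. by rewrite !(hsipC x) hsipDl. Qed.

Lemma hsipZr c a x : hsip x (c%:C *: a) = c * hsip x a.
Proof. by rewrite !(hsipC x) hsipZl. Qed.

Lemma hsip0r x : hsip x 0 = 0.
Proof. by rewrite hsipC hsip0l. Qed.

Lemma hsipBr a b x : hsip x (a - b) = hsip x a - hsip x b.
Proof. by rewrite !(hsipC x) hsipBl. Qed.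

Lemma hsip_sumr (I : Type) (r : seq I) (P : pred I) (F : I -> 'M[R[i]]_n) x :
  hsip x (\sum_(i <- r | P i) F i) = \sum_(i <- r | P i) hsip x (F i).
Proof. by rewrite hsipC hsip_suml; apply: eq_bigr => i _; rewrite hsipC. Qed.

Lemma adjmxD a b : adjmx (a + b) = adjmx a + adjmx b.
Proof. by rewrite /adjmx linearD map_mxD. Qed.

Lemma adjmxZ c a : adjmx (c%:C *: a) = c%:C *: adjmx a.
Proof. by rewrite /adjmx linearZ map_mxZ /= /Num.conj /= oppr0. Qed.

Lemma hermP a : a \is hermsymmx <-> adjmx a = a.
Proof.
split=> [/hermE //|ha]; apply/is_hermitianmxP.
by rewrite expr0 scale1r -{1}ha.
Qed.

Lemma herm0 : (0 : 'M[R[i]]_n) \is hermsymmx.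
Proof. by apply/hermP; rewrite /adjmx trmx0 map_mx0. Qed.

Lemma hermD a b : a \is hermsymmx -> b \is hermsymmx -> a + b \is hermsymmx.
Proof. by move=> /hermP ha /hermP hb; apply/hermP; rewrite adjmxD ha hb. Qed.

Lemma hermZ c a : a \is hermsymmx -> c%:C *: a \is hermsymmx.
Proof. by move=> /hermP ha; apply/hermP; rewrite adjmxZ ha. Qed.

Lemma hermB a b : a \is hermsymmx -> b \is hermsymmx -> a - b \is hermsymmx.
Proof.
move=> ha hb; apply: hermD; first exact: ha.
have -> : - b = (- 1)%:C *: b by rewrite rmorphN rmorph1 scaleN1r.
exact: hermZ.
Qed.

Lemma herm_sum (I : Type) (r : seq I) (P : pred I) (F : I -> 'M[R[i]]_n) :
  (forall i, P i -> F i \is hermsymmx) ->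
  \sum_(i <- r | P i) F i \is hermsymmx.
Proof. by move=> hF; elim/big_ind: _; [exact: herm0|exact: hermD|exact: hF]. Qed.

(** Replacing one factor by its adjoint turns the trace of the square into a sum of squared moduli;
    positive definiteness of [hsip] on Hermitian matrices rests on this. *)
Lemma hsipE_herm a : a \is hermsymmx ->
  hsip a a = \sum_i \sum_j
    (complex.Re (a i j) ^+ 2 + complex.Im (a i j) ^+ 2).
Proof.
move=> /hermP ha; rewrite /hsip -{2}ha /mxtrace Re_sum; apply: eq_bigr => i _.
rewrite mxE Re_sum; apply: eq_bigr => j _; rewrite /adjmx !mxE.
by rewrite /Num.conj /=; case: (a i j) => p q /=; rewrite mulrN opprK !expr2.
Qed.

Lemma hsip_ge0 a : a \is hermsymmx -> 0 <= hsip a a.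
Proof.
move=> ha; rewrite hsipE_herm //; apply: sumr_ge0 => i _; apply: sumr_ge0 => j _.
by rewrite addr_ge0 // sqr_ge0.
Qed.

Lemma hsip_eq0 a : a \is hermsymmx -> hsip a a = 0 -> a = 0.
Proof.
have pos i j : 0 <= complex.Re (a i j) ^+ 2 + complex.Im (a i j) ^+ 2.
  by rewrite addr_ge0 // sqr_ge0.
move=> ha; rewrite hsipE_herm // => /eqP.
rewrite psumr_eq0 => [/allP h|i _]; last exact: sumr_ge0.
apply/matrixP => i j; rewrite mxE.
have := h i (mem_index_enum _); rewrite psumr_eq0 => [/allP/(_ j (mem_index_enum _))|//].
rewrite /= paddr_eq0 ?sqr_ge0 // !sqrf_eq0.
by case: (a i j) => p q /= /andP[/eqP-> /eqP->].
Qed.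

Lemma hsip_gt0 a : a \is hermsymmx -> a != 0 -> 0 < hsip a a.
Proof.
move=> ha a0; rewrite lt_def hsip_ge0 // andbT; apply: contra a0 => /eqP.
by move=> /(hsip_eq0 ha) ->.
Qed.

Lemma hsip_CauchySchwarz a b : a \is hermsymmx -> b \is hermsymmx ->
  `|hsip a b| <= hsnorm a * hsnorm b.
Proof.
move=> ha hb; rewrite /hsnorm -sqrtrM ?hsip_ge0 // -sqrtr_sqr ler_wsqrtr //.
have [->|b0] := eqVneq b 0; first by rewrite !hsip0r expr0n mulr0.
have bb := hsip_gt0 hb b0.
(* The residual of a after projection onto the line of b has nonnegative square norm. *)
have := hsip_ge0 (hermB ha (hermZ (hsip a b / hsip b b) hb)).
rewrite hsipBl !hsipBr !hsipZl !hsipZr (hsipC b a) divfK ?gt_eqF //.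
rewrite subrr subr0 subr_ge0 mulrAC -expr2 ler_pdivrMr //.
Qed.

End Fixed.
End HilbertSchmidt.

(** * Real spans and dual bases *)

Section Span.
Context {R : realType} {n : nat}.
Implicit Types (X V : set 'M[R[i]]_n) (x y : 'M[R[i]]_n) (c : R).

Lemma rspan0 X : rspan X 0.
Proof.
by exists 0%N, (fun=> 0), (fun=> 0); split=> [[]//|]; rewrite big_ord0.
Qed.

Lemma sub_rspan X : X `<=` rspan X.
Proof.
move=> x Xx; exists 1%N, (fun=> 1), (fun=> x); split=> //.
by rewrite big_ord1 rmorph1 scale1r.
Qed.

Lemma rspanD X x y : rspan X x -> rspan X y -> rspan X (x + y).
Proof.
move=> [m [c [v [hv ->]]]] [p [d [w [hw ->]]]].
exists (m + p)%N, (fun i => match fintype.split i with inl j => c j | inr j => d j end),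
  (fun i => match fintype.split i with inl j => v j | inr j => w j end); split.
  by move=> i; case: (fintype.split i).
rewrite big_split_ord /=; congr (_ + _); apply: eq_bigr => i _.
  by rewrite (unsplitK (inl i)).
by rewrite (unsplitK (inr i)).
Qed.

Lemma rspanZ X c x : rspan X x -> rspan X (c%:C *: x).
Proof.
move=> [m [d [v [hv ->]]]]; exists m, (fun i => c * d i), v; split=> //.
by rewrite scaler_sumr; apply: eq_bigr => i _; rewrite rmorphM scalerA.
Qed.

Lemma rspanB X x y : rspan X x -> rspan X y -> rspan X (x - y).
Proof.
move=> hx /(rspanZ (-1)); rewrite rmorphN rmorph1 scaleN1r; exact: rspanD.
Qed.

Lemma rspan_sum X (I : Type) (r : seq I) (P : pred I) (F : I -> 'M[R[i]]_n) :
  (forall i, P i -> rspan X (F i)) -> rspan X (\sum_(i <- r | P i) F i).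
Proof. by move=> hF; elim/big_ind: _; [exact: rspan0|exact: rspanD|exact: hF]. Qed.

Lemma rspan_herm X : (forall x, X x -> x \is hermsymmx) ->
  forall x, rspan X x -> x \is hermsymmx.
Proof.
by move=> hX _ [m [c [v [hv ->]]]]; apply: herm_sum => i _; apply/hermZ/hX.
Qed.

Lemma rspan_orth X z : (forall x, X x -> hsip z x = 0) ->
  forall x, rspan X x -> hsip z x = 0.
Proof.
move=> h _ [m [c [v [hv ->]]]]; rewrite hsip_sumr big1 // => i _.
by rewrite hsipZr h // mulr0.
Qed.

Definition biorthogonal m (v w : nat -> 'M[R[i]]_n) :=
  forall i j, (i < m)%N -> (j < m)%N -> hsip (v i) (w j) = (i == j)%:R.

(** The [v i] lie in X itself, so that functions of interest only on X can be evaluated at them,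
    while the [w i] read off coordinates. Indexing by [nat] lets a family grow by one element
    without casts between ordinals. *)
Definition dual_bases X m (v w : nat -> 'M[R[i]]_n) :=
  [/\ forall i, (i < m)%N -> X (v i), forall i, (i < m)%N -> rspan X (w i),
      biorthogonal m v w
    & forall x, rspan X x -> x = \sum_(i < m) (hsip x (w i))%:C *: v i].

(* For Hermitian matrices the complex trace pairing is real, so real
   biorthogonality is complex biorthogonality and the family is C-free. *)
Lemma biorthogonal_bound m (v w : nat -> 'M[R[i]]_n) :
  (forall i, (i < m)%N -> v i \is hermsymmx) ->
  (forall i, (i < m)%N -> w i \is hermsymmx) ->
  biorthogonal m v w -> (m <= n * n)%N.
Proof.
move=> hv hw vw.
pose A := \matrix_(i < m) mxvec (v i); pose B := \matrix_(i < m) mxvec (w i)^T.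
suff : A *m B^T = 1%:M by exact: mulmx1_min.
apply/matrixP => i j; rewrite !mxE.
transitivity (\tr (v i *m w j)); last first.
  have /complex_realP[p hp] := mxtrace_herm_real (hv i (ltn_ord i)) (hw j (ltn_ord j)).
  have := vw i j (ltn_ord i) (ltn_ord j); rewrite /hsip hp /= => ->.
  by rewrite -val_eqE /=; case: (_ == _).
rewrite /mxtrace; under [RHS]eq_bigr do rewrite mxE.
rewrite pair_big /= (reindex _ (curry_mxvec_bij n n)) /=.
by apply: eq_bigr => -[p q] _ /=; rewrite !mxE !mxvecE !mxE.
Qed.

(** If no biorthogonal family spanned, each could be extended by one more pair, and length
    [(n * n).+1] would contradict [biorthogonal_bound]. *)
Lemma dual_bases_exist X : (forall x, X x -> x \is hermsymmx) ->
  exists m v w, dual_bases X m v w.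
Proof.
move=> hX; apply: contrapT => nob.
suff [v [w [hv hw vw]]] : exists v w,
    [/\ forall i, (i < (n * n).+1)%N -> X (v i),
        forall i, (i < (n * n).+1)%N -> rspan X (w i)
      & biorthogonal (n * n).+1 v w].
  have := @biorthogonal_bound (n * n).+1 v w; rewrite ltnn => h.
  by apply/notF/h => // i im; [exact/hX/hv|exact/(rspan_herm hX)/hw].
elim: (n * n).+1 => [|m [v [w [hv hw vw]]]].
  by exists (fun=> 0), (fun=> 0).
have hvH i : (i < m)%N -> v i \is hermsymmx by move=> /hv /hX.
(* If every element of X had this expansion, so would the whole span by linearity, and v, w would
   already be dual bases. *)
have [x Xx xne] : exists2 x, X x & x != \sum_(i < m) (hsip x (w i))%:C *: v i.
  apply: contrapT => /forallPNP nx; apply: nob; exists m, v, w; split=> //.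
  move=> y [p [c [u [hu ->]]]].
  transitivity
    (\sum_(i < p) \sum_(j < m) (c i * hsip (u i) (w j))%:C *: v j).
    apply: eq_bigr => i _; have := nx _ (hu i); move/negP; rewrite negbK => /eqP {1}->.
    by rewrite scaler_sumr; apply: eq_bigr => j _; rewrite rmorphM scalerA.
  rewrite exchange_big /=; apply: eq_bigr => j _; rewrite -scaler_suml -rmorph_sum /=.
  by rewrite hsip_suml; congr (_%:C *: _); apply: eq_bigr => i _; rewrite hsipZl.
pose y := x - \sum_(i < m) (hsip x (w i))%:C *: v i.
have spy : rspan X y.
  apply: rspanB; first exact: sub_rspan.
  by apply: rspan_sum => i _; apply/rspanZ/sub_rspan/hv.
have yH : y \is hermsymmx by exact: rspan_herm spy.
have y0 : y != 0 by rewrite subr_eq0.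
have yw j : (j < m)%N -> hsip y (w j) = 0.
  move=> jm; rewrite hsipBl hsip_suml (bigD1 (Ordinal jm)) //= hsipZl vw // eqxx.
  rewrite mulr1 big1 ?addr0 ?subrr // => i; rewrite -val_eqE /= => ij.
  by rewrite hsipZl vw // (negbTE ij) mulr0.
(* The residual y is orthogonal to every [w j]; correcting it by the w family makes z orthogonal to
   every [v j] while keeping its pairing with x equal to the nonzero [hsip y y]. *)
pose z := y - \sum_(i < m) (hsip y (v i))%:C *: w i.
have spz : rspan X z.
  by apply: rspanB => //; apply: rspan_sum => i _; apply/rspanZ/hw.
have zv j : (j < m)%N -> hsip (v j) z = 0.
  move=> jm; rewrite hsipBr hsip_sumr (bigD1 (Ordinal jm)) //= hsipZr vw // eqxx.
  rewrite mulr1 hsipC big1 ?addr0 ?subrr // => i; rewrite -val_eqE /= => ij.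
  by rewrite hsipZr vw // eq_sym (negbTE ij) mulr0.
have xz : hsip x z = hsip y y.
  transitivity (hsip y z).
    rewrite [in RHS]/y hsipBl hsip_suml big1 ?subr0 // => i _.
    by rewrite hsipZl zv // mulr0.
  rewrite hsipBr hsip_sumr big1 ?subr0 // => i _.
  by rewrite hsipZr yw // mulr0.
have yy : hsip y y != 0 by rewrite gt_eqF // hsip_gt0.
pose t := (hsip y y)^-1.
(* The new pair is x with a rescaled z; a multiple of z is subtracted from each old [w i] so that it
   annihilates x, which leaves its pairings with the old v unchanged. *)
exists (fun i => if i == m then x else v i),
  (fun i => if i == m then t%:C *: z else w i - (hsip x (w i) * t)%:C *: z).
split.
- by move=> i; rewrite ltnS leq_eqVlt; case: eqP => //= _ /hv.
- move=> i; rewrite ltnS leq_eqVlt; case: eqP => /= [_ _|_ im]; first exact: rspanZ.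
  by apply: rspanB; [exact: hw|exact: rspanZ].
- move=> i j; rewrite !ltnS (leq_eqVlt i) (leq_eqVlt j).
  case: (eqVneq i m) => /= [-> _|im hi]; case: (eqVneq j m) => [jE|jm] /= hj.
  + by rewrite hsipZr xz mulVf.
  + by rewrite hsipBr hsipZr xz mulfVK // subrr.
  + by rewrite hsipZr zv // mulr0 jE (negbTE im).
  + by rewrite hsipBr hsipZr zv // mulr0 subr0 vw.
Qed.

(** The roles of v and w can be exchanged: the difference of the two sides is orthogonal to every
    [v i], hence to itself, since the v expand the whole span. *)
Lemma dual_bases_expand X m v w : (forall x, X x -> x \is hermsymmx) ->
  dual_bases X m v w ->
  forall x, rspan X x -> x = \sum_(i < m) (hsip x (v i))%:C *: w i.
Proof.
move=> hX [hv hw vw hx] x sx; apply/eqP; rewrite -subr_eq0; apply/eqP.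
set y := x - _.
have sy : rspan X y.
  by apply: rspanB => //; apply: rspan_sum => i _; apply/rspanZ/hw.
have yv j : (j < m)%N -> hsip y (v j) = 0.
  move=> jm; rewrite hsipBl hsip_suml (bigD1 (Ordinal jm)) //= hsipZl (hsipC (w j)).
  rewrite vw // eqxx.
  rewrite mulr1 big1 ?addr0 ?subrr // => i; rewrite -val_eqE /= => ij.
  by rewrite hsipZl (hsipC (w i)) vw // eq_sym (negbTE ij) mulr0.
apply: hsip_eq0; first exact: (rspan_herm hX).
rewrite {2}(hx _ sy) hsip_sumr big1 // => i _.
by rewrite hsipZr yv ?mulr0.
Qed.

End Span.

(** * Orthogonal projection onto a real span *)

Section OrthogonalProjection.
Context {R : realType} {n : nat}.
Implicit Types (X : set 'M[R[i]]_n) (x y : 'M[R[i]]_n) (c : R).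

(** Dual bases supply the projection explicitly, as the sum of the [v i] with coefficients
    [hsip x (w i)]. *)
Lemma orthprojP X x : (forall x, X x -> x \is hermsymmx) ->
  rspan X (orthproj (rspan X) x) /\
  forall v, rspan X v -> hsip (x - orthproj (rspan X) x) v = 0.
Proof.
move=> hX; rewrite /orthproj.
set P := [set y | _]; suff [y Py] : exists y, P y by exact: xgetPex (ex_intro _ y Py).
have [m [v [w db]]] := dual_bases_exist hX.
have [hv hw vw _] := db; exists (\sum_(i < m) (hsip x (w i))%:C *: v i); split.
  by apply: rspan_sum => i _; apply/rspanZ/sub_rspan/hv.
move=> z /(dual_bases_expand hX db) ->; rewrite hsip_sumr big1 // => j _.
rewrite hsipZr hsipBl hsip_suml (bigD1 j) //= hsipZl vw // eqxx mulr1 big1.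
  by rewrite addr0 subrr mulr0.
by move=> i ij; rewrite hsipZl vw // (negbTE (ij : (i : nat) != j)) mulr0.
Qed.

Lemma orthproj_uniq X x y : (forall x, X x -> x \is hermsymmx) ->
  rspan X y -> (forall v, rspan X v -> hsip (x - y) v = 0) ->
  orthproj (rspan X) x = y.
Proof.
move=> hX sy oy; have [sz oz] := orthprojP x hX.
set z := orthproj _ _ in sz oz *.
have szy : rspan X (z - y) by exact: rspanB.
apply/eqP; rewrite -subr_eq0; apply/eqP; apply: hsip_eq0.
  exact: rspan_herm szy.
have e : z - y = (x - y) - (x - z) by rewrite opprB [RHS]addrC subrKA.
by rewrite {1}e hsipBl oy // oz // subr0.
Qed.

Lemma orthprojD X x y : (forall x, X x -> x \is hermsymmx) ->
  orthproj (rspan X) (x + y) = orthproj (rspan X) x + orthproj (rspan X) y.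
Proof.
move=> hX; have [sx ox] := orthprojP x hX; have [sy oy] := orthprojP y hX.
apply: orthproj_uniq => //; first exact: rspanD.
by move=> v sv; rewrite opprD addrACA hsipDl ox // oy // addr0.
Qed.

Lemma orthprojZ X c x : (forall x, X x -> x \is hermsymmx) ->
  orthproj (rspan X) (c%:C *: x) = c%:C *: orthproj (rspan X) x.
Proof.
move=> hX; have [sx ox] := orthprojP x hX.
apply: orthproj_uniq => //; first exact: rspanZ.
by move=> v sv; rewrite -scalerBr hsipZl ox // mulr0.
Qed.

Lemma orthproj0 X : (forall x, X x -> x \is hermsymmx) ->
  orthproj (rspan X) 0 = 0.
Proof.
move=> hX; apply: orthproj_uniq => //; first exact: rspan0.
by move=> v _; rewrite subr0 hsip0l.
Qed.

Lemma hsip_orthprojl X x y : (forall x, X x -> x \is hermsymmx) ->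
  rspan X y -> hsip (orthproj (rspan X) x) y = hsip x y.
Proof.
move=> hX sy; have [_ /(_ y sy)/eqP] := orthprojP x hX.
by rewrite hsipBl subr_eq0 => /eqP.
Qed.

End OrthogonalProjection.

(** * The tensor representing the identity map *)

Section ChoiUniqueness.
Context {R : realType} {n : nat}.
Implicit Types (X : set 'M[R[i]]_n).

Lemma tensmxZl c (a x : 'M[R[i]]_n) : (c *: a) *t x = c *: (a *t x).
Proof. by apply/matrixP => i j; rewrite !mxE mulrA. Qed.

Lemma herm_tens (a b : 'M[R[i]]_n) : a \is hermsymmx -> b \is hermsymmx ->
  a *t b \is hermsymmx.
Proof.
move=> /hermP ha /hermP hb; apply/hermP; rewrite -{2}ha -{2}hb.
by rewrite /adjmx trmx_tens; apply/matrixP => i j; rewrite !mxE rmorphM.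
Qed.

Lemma tens_space_herm X : (forall x, X x -> x \is hermsymmx) ->
  forall J, tens_space X J -> J \is hermsymmx.
Proof.
by move=> hX; apply: rspan_herm => _ [a Xa [b Xb <-]]; apply: herm_tens; exact: hX.
Qed.

(** Two tensors with the same pairings differ by an element of the tensor space orthogonal to all
    its product generators, hence to itself. *)
Lemma choi_idE X J : (forall x, X x -> x \is hermsymmx) ->
  tens_space X J ->
  (forall r s, X r -> X s -> hsip r s = hsip J (r *t s)) ->
  choi X id = J.
Proof.
move=> hX tJ pJ; rewrite /choi.
set P := [set J | _]; have PJ : P J by [].
have [tK pK] : P (xget 0 P) := xgetPex 0 (ex_intro _ J PJ).
apply/eqP; rewrite -subr_eq0; apply/eqP.
have tD : tens_space X (xget 0 P - J) by exact: rspanB.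
apply: hsip_eq0; first exact: tens_space_herm tD.
apply: rspan_orth tD => _ [a Xa [b Xb <-]].
by rewrite hsipBl -pJ // -pK // subrr.
Qed.

(** Existence comes from dual bases: the sum of the [w i *t v i] represents the inner product. *)
Lemma choi_idP X : (forall x, X x -> x \is hermsymmx) ->
  forall r s, rspan X r -> rspan X s ->
    hsip r s = hsip (choi (rspan X) id) (r *t s).
Proof.
move=> hX; have hV := rspan_herm hX.
have [m [v [w db]]] := dual_bases_exist hX; have [hv hw vw ex] := db.
have tJ : tens_space (rspan X) (\sum_(i < m) w i *t v i).
  apply: rspan_sum => i _; apply: sub_rspan; exists (w i); first exact: hw.
  by exists (v i) => //; apply/sub_rspan/hv.
have pJ r s : rspan X r -> rspan X s ->
    hsip r s = hsip (\sum_(i < m) w i *t v i) (r *t s).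
  move=> hr hs; rewrite {1}(ex r hr) !hsip_suml; apply: eq_bigr => i _.
  rewrite hsipZl hsip_tens ?hV //; first by rewrite (hsipC r).
  - exact: hw.
  - exact/sub_rspan/hv.
by rewrite (choi_idE hV tJ pJ).
Qed.

End ChoiUniqueness.

(** * Extending affine functions on a convex set to linear combinations *)

Section AffineExtension.
Context {R : realType} {n : nat}.
Variables (X : set 'M[R[i]]_n) (g : 'M[R[i]]_n -> R).
Hypothesis X_convex : forall (p : R) x y, 0 <= p <= 1 -> X x -> X y ->
  X (p%:C *: x + (1 - p)%:C *: y).
Hypothesis g_affine : forall (p : R) x y, 0 <= p <= 1 -> X x -> X y ->
  g (p%:C *: x + (1 - p)%:C *: y) = p * g x + (1 - p) * g y.

(** Induction on m: the barycentre of m + 1 points is the two-point mixture, with weight [u / v], of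
    the barycentre of the first m and the last point. If the first m weights vanish, only the last
    point remains. *)
Lemma affine_conv m (p : nat -> R) (x : nat -> 'M[R[i]]_n) :
  (forall i, (i < m)%N -> 0 <= p i) -> (forall i, (i < m)%N -> X (x i)) ->
  let t := \sum_(i < m) p i in 0 < t ->
  X (t^-1%:C *: \sum_(i < m) (p i)%:C *: x i) /\
  g (t^-1%:C *: \sum_(i < m) (p i)%:C *: x i) = t^-1 * \sum_(i < m) p i * g (x i).
Proof.
elim: m => [|m IH] hp hx t; first by rewrite /t big_ord0 ltxx.
have hp' i : (i < m)%N -> 0 <= p i by move=> im; apply/hp/ltnW.
have hx' i : (i < m)%N -> X (x i) by move=> im; apply/hx/ltnW.
have := IH hp' hx'; rewrite /t !big_ord_recr /=.
set u := \sum_(i < m) p i; set y := \sum_(i < m) _ *: _; set z := \sum_(i < m) _ * _.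
move=> {}IH t0.
have u0 : 0 <= u by apply: sumr_ge0 => i _; exact: hp'.
have pm : 0 <= p m by exact: hp.
have xm : X (x m) by exact: hx.
have [ue|un] := eqVneq u 0.
  have pz (i : 'I_m) : p i = 0.
    move/eqP: ue; rewrite psumr_eq0 => [/allP/(_ i (mem_index_enum _))/eqP //|j _].
    exact: hp'.
  have -> : y = 0 by apply: big1 => i _; rewrite pz scale0r.
  have -> : z = 0 by apply: big1 => i _; rewrite pz mul0r.
  move: t0; rewrite ue !add0r => t0.
  rewrite scalerA -rmorphM mulVf ?gt_eqF // rmorph1 scale1r mulrA mulVf ?gt_eqF //.
  by rewrite mul1r.
have {}u0 : 0 < u by rewrite lt_def un.
have [Xy gy] := IH u0.
set v := u + p m in t0 *.
have v0 : v != 0 by rewrite gt_eqF.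
have pe : 1 - u / v = v^-1 * p m by rewrite /v; field.
have pb : 0 <= u / v <= 1.
  apply/andP; split; first exact: divr_ge0 (ltW u0) (ltW t0).
  by rewrite ler_pdivrMr // mul1r lerDl.
have -> : v^-1%:C *: (y + (p m)%:C *: x m) =
    (u / v)%:C *: (u^-1%:C *: y) + (1 - u / v)%:C *: x m.
  rewrite pe scalerDr !scalerA -!rmorphM mulrAC divff ?mul1r //.
split; first exact: X_convex.
rewrite g_affine // gy pe mulrA [u / v * _]mulrAC divff // mul1r mulrDr.
by rewrite mulrA.
Qed.

(** The positive and negative parts of c have equal total mass and equal barycentre, so
    [affine_conv] assigns the same value of g to both. *)
Lemma affine_relation m (c : nat -> R) (x : nat -> 'M[R[i]]_n) :
  (forall i, (i < m)%N -> X (x i)) ->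
  \sum_(i < m) c i = 0 -> \sum_(i < m) (c i)%:C *: x i = 0 ->
  \sum_(i < m) c i * g (x i) = 0.
Proof.
move=> hx c0 cx0.
pose p i := Num.max (c i) 0; pose q i := Num.max (- c i) 0.
have p0 i : 0 <= p i by rewrite le_max lexx orbT.
have q0 i : 0 <= q i by rewrite le_max lexx orbT.
have cE i : c i = p i - q i.
  by rewrite /p /q; case: (leP (c i) 0) => h; case: (leP (- c i) 0) => h'; lra.
have pq : \sum_(i < m) p i = \sum_(i < m) q i.
  by apply/eqP; rewrite -subr_eq0 -sumrB -[X in _ == X]c0; apply/eqP/eq_bigr => i _.
have pqx : \sum_(i < m) (p i)%:C *: x i = \sum_(i < m) (q i)%:C *: x i.
  apply/eqP; rewrite -subr_eq0 -sumrB -[X in _ == X]cx0; apply/eqP/eq_bigr => i _.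
  by rewrite cE rmorphB scalerBl.
suff : \sum_(i < m) p i * g (x i) = \sum_(i < m) q i * g (x i).
  move=> e; apply/eqP; move/eqP: e; rewrite -subr_eq0 -sumrB.
  by congr (_ == _); apply: eq_bigr => i _; rewrite cE mulrBl.
have [pe|pn] := eqVneq (\sum_(i < m) p i) 0.
  have z (r : nat -> R) : (forall i, 0 <= r i) -> \sum_(i < m) r i = 0 ->
      \sum_(i < m) r i * g (x i) = 0.
    move=> r0 /eqP; rewrite psumr_eq0 // => /allP h; apply: big1 => i _.
    by have /eqP -> := h i (mem_index_enum _); rewrite mul0r.
  by rewrite !z // -pq.
have t0 : 0 < \sum_(i < m) p i by rewrite lt_def pn sumr_ge0.
have [_ gp] := affine_conv (fun i _ => p0 i) hx t0.
have t0' : 0 < \sum_(i < m) q i by rewrite -pq.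
have [_ gq] := affine_conv (fun i _ => q0 i) hx t0'.
apply: (mulfI (_ : (\sum_(i < m) p i)^-1 != 0)); first by rewrite invr_eq0.
by rewrite -gp pqx {1 2}pq gq.
Qed.

Lemma affine_comb m (c : nat -> R) (x : nat -> 'M[R[i]]_n) y :
  X y -> (forall i, (i < m)%N -> X (x i)) ->
  \sum_(i < m) c i = 1 -> y = \sum_(i < m) (c i)%:C *: x i ->
  g y = \sum_(i < m) c i * g (x i).
Proof.
move=> Xy hx c1 yE.
have := @affine_relation m.+1 (fun i => if i is j.+1 then c j else -1)
  (fun i => if i is j.+1 then x j else y).
(* The point y with coefficient -1 turns the expansion into a relation of total weight 0. *)
rewrite !big_ord_recl /= c1 -yE addNr rmorphN rmorph1 scaleN1r addNr => /(_ _ erefl erefl).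
rewrite mulN1r => h; apply/esym/eqP; rewrite -subr_eq0 addrC; apply/eqP/h.
by case=> // j /hx.
Qed.

(** The point 0, where g vanishes, absorbs the missing weight [1 - \sum_(i < m) c i], which reduces
    the claim to [affine_comb]. *)
Lemma affine_lincomb m (c : nat -> R) (x : nat -> 'M[R[i]]_n) y :
  X 0 -> g 0 = 0 ->
  X y -> (forall i, (i < m)%N -> X (x i)) -> y = \sum_(i < m) (c i)%:C *: x i ->
  g y = \sum_(i < m) c i * g (x i).
Proof.
move=> X0 g0 Xy hx yE.
have := @affine_comb m.+1
  (fun i => if i is j.+1 then c j else 1 - \sum_(i < m) c i)
  (fun i => if i is j.+1 then x j else 0) y Xy.
rewrite !big_ord_recl /= subrK g0 mulr0 scaler0 !add0r; apply=> //.
by case=> // j /hx.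
Qed.

End AffineExtension.

(** * Conic Caratheodory reduction and closedness of sums of rank-one products *)

Section ConicCaratheodory.
Context {R : realType}.

(* A linear relation with coefficients c, scaled so that its largest
   coefficient in absolute value is c_k = 1, removes the k-th term:
   \sum_i x_i = \sum_i (1 - c_i) x_i with all 1 - c_i >= 0. *)
Lemma conic_caratheodory d m (P : set 'rV[R]_d) (x : 'I_m -> 'rV[R]_d) :
  P 0 -> (forall c y, 0 <= c -> P y -> P (c *: y)) -> (forall i, P (x i)) ->
  exists y : 'I_d -> 'rV[R]_d,
    (forall i, P (y i)) /\ \sum_i x i = \sum_i y i.
Proof.
move=> P0 PZ; elim: m x => [|m IH] x Px.
  by exists (fun=> 0); split=> //; rewrite big_ord0 big1.
have [md|dm] := leqP m.+1 d.
  (* With at most d terms it suffices to pad by zeros. *)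
  exists (fun i : 'I_d => oapp x 0 (insub (i : nat))); split.
    by move=> i; case: (insub _) => [u|] /=; [exact: Px|exact: P0].
  rewrite (bigID (fun i : 'I_d => (i < m.+1)%N)) /= [X in _ + X]big1 => [|i im].
    rewrite addr0 big_ord_narrow; apply: eq_bigr => i _ /=.
    by rewrite (valK i).
  by rewrite insubN.
pose A := \matrix_(i < m.+1) x i.
have : kermx A != 0.
  rewrite kermx_eq0 /row_free neq_ltn; apply/orP; left.
  exact: leq_ltn_trans (rank_leq_col A) dm.
move=> /rowV0Pn[c /sub_kermxP cA c0].
have [k _ ck] : exists2 k, true & forall i, `|c 0 i| <= `|c 0 k|.
  have [k _ kmax] := arg_maxP (fun i => `|c 0 i|) (isT : xpredT (ord0 : 'I_m.+1)).
  by exists k => // i; exact: kmax.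
have ck0 : c 0 k != 0.
  apply: contra c0 => /eqP e; apply/eqP/rowP => i; rewrite mxE.
  by have := ck i; rewrite e normr0 normr_le0 => /eqP.
have rel : \sum_i c 0 i *: x i = 0.
  apply/rowP => j; have := congr1 (fun M : 'rV_d => M 0 j) cA.
  rewrite !mxE => cAj; rewrite summxE -[RHS]cAj.
  by apply: eq_bigr => i _; rewrite !mxE.
pose x' i := (1 - c 0 i / c 0 k) *: x i.
have -> : \sum_i x i = \sum_i x' i.
  under [RHS]eq_bigr do rewrite /x' scalerBl scale1r.
  rewrite sumrB -[LHS]subr0; congr (_ - _); symmetry.
  under eq_bigr do rewrite mulrC -scalerA.
  by rewrite -scaler_sumr rel scaler0.
rewrite (bigD1_ord k) //= {1}/x' divff // subrr scale0r add0r.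
apply: IH => i; apply: PZ => //; rewrite subr_ge0.
apply: le_trans (ler_norm _) _; rewrite normrM normfV.
by rewrite ler_pdivrMr ?normr_gt0 // mul1r.
Qed.

Definition dual_cone p (A : set 'rV[R]_p) : set 'rV[R]_p :=
  [set f | forall a, A a -> 0 <= \sum_i a 0 i * f 0 i].

Lemma dual_cone0 p (A : set 'rV[R]_p) : dual_cone A 0.
Proof. by move=> a _; rewrite big1 // => i _; rewrite mxE mulr0. Qed.

Lemma dual_coneZ p (A : set 'rV[R]_p) c f :
  0 <= c -> dual_cone A f -> dual_cone A (c *: f).
Proof.
move=> c0 hf a Aa; have := mulr_ge0 c0 (hf a Aa); rewrite mulr_sumr.
by congr (0 <= _); apply: eq_bigr => i _; rewrite mxE mulrCA.
Qed.

Lemma dual_cone_ge0 p (A : set 'rV[R]_p) f :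
  (forall i, A (delta_mx 0 i)) -> dual_cone A f -> forall i, 0 <= f 0 i.
Proof.
move=> hA hf i; have := hf _ (hA i); rewrite (bigD1 i) //= big1 ?addr0.
  by rewrite mxE !eqxx mul1r.
by move=> j ji; rewrite mxE (negbTE ji) andbF mul0r.
Qed.

(** Moving the factor t, the sum of the entries of f, from f to g keeps the product; the entries of
    f then sum to 1, and those of g become the column sums of the product. If t is 0, then f is 0
    and both factors may be taken null. *)
Lemma rank1_normalize p q (A : set 'rV[R]_p) (B : set 'rV[R]_q) f g :
  (forall i, A (delta_mx 0 i)) -> dual_cone A f -> dual_cone B g ->
  exists f' g', [/\ dual_cone A f', dual_cone B g',
    f'^T *m g' = f^T *m g,
    forall i, f' 0 i <= 1 & forall j, g' 0 j <= \sum_i (f^T *m g) i j].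
Proof.
move=> hA hf hg; have f0 := dual_cone_ge0 hA hf.
pose t := \sum_i f 0 i.
have t0 : 0 <= t by exact: sumr_ge0.
have colE j : \sum_i (f^T *m g) i j = t * g 0 j.
  by rewrite mulr_suml; apply: eq_bigr => i _; rewrite mxE big_ord1 mxE.
have [te|tn] := eqVneq t 0.
  have fE : f = 0.
    apply/rowP => i; rewrite mxE; apply/eqP.
    by move/eqP: te; rewrite psumr_eq0 // => /allP/(_ i (mem_index_enum _)).
  exists 0, 0; split; rewrite ?fE ?trmx0 ?mul0mx //; try exact: dual_cone0.
  - by move=> i; rewrite mxE ler01.
  - by move=> j; rewrite mxE big1 // => i _; rewrite mxE.
exists (t^-1 *: f), (t *: g); split.
- by apply: dual_coneZ => //; rewrite invr_ge0.
- exact: dual_coneZ.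
- by rewrite [(t^-1 *: f)^T]linearZ /= -scalemxAl -scalemxAr scalerA mulVf // scale1r.
- move=> i; rewrite mxE mulrC ler_pdivrMr ?lt_def ?tn // mul1r /t (bigD1 i) //=.
  by rewrite lerDl sumr_ge0.
- by move=> j; rewrite colE mxE.
Qed.

Lemma cvg_sumr (F : set_system nat) {FF : Filter F} m
    (u : 'I_m -> nat -> R) (l : 'I_m -> R) :
  (forall i, u i @ F --> l i) -> (fun N => \sum_i u i N) @ F --> \sum_i l i.
Proof. by move=> ul; apply: cvg_big => //; exact: add_continuous. Qed.

(** Compactness of the segment gives a cluster point, and an ultrafilter converges to each of its
    cluster points. *)
Lemma ultra_bounded_cvg (U : set_system nat) {UU : UltraFilter U} (u : nat -> R)
    (a b : R) : (\forall N \near U, a <= u N <= b) ->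
  exists l : R, u @ U --> l.
Proof.
move=> ub; have Uab : (u @ U) [set` `[a, b]] by apply: filterS ub => N; rewrite /= in_itv.
have [l [_ cl]] := @segment_compact R a b (u @ U) _ Uab.
exists l => B Bl; have [//|UnB] := in_ultra_setVsetC (u @^-1` B) UU.
by have [x [nBx Bx]] := cl (~` B) B UnB Bl.
Qed.

Lemma rank1_sums_closed p q (A : set 'rV[R]_p) (B : set 'rV[R]_q)
    (m : nat -> nat) (f : nat -> nat -> 'rV[R]_p) (g : nat -> nat -> 'rV[R]_q)
    (M : 'M[R]_(p, q)) :
  (forall i, A (delta_mx 0 i)) -> (forall j, B (delta_mx 0 j)) ->
  (forall N k, dual_cone A (f N k)) -> (forall N k, dual_cone B (g N k)) ->
  (forall i j,
    (fun N => \sum_(k < m N) f N k 0 i * g N k 0 j) @ \oo --> M i j) ->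
  exists D (f' : 'I_D -> 'rV[R]_p) (g' : 'I_D -> 'rV[R]_q),
    [/\ forall k, dual_cone A (f' k), forall k, dual_cone B (g' k)
      & M = \sum_k (f' k)^T *m g' k].
Proof.
move=> hA hB hf hg cM.
pose Q N := \sum_(k < m N) (f N k)^T *m g N k.
have QE N i j : Q N i j = \sum_(k < m N) f N k 0 i * g N k 0 j.
  by rewrite summxE; apply: eq_bigr => k _; rewrite mxE big_ord1 mxE.
(* The dimension of the space of p by q matrices: [conic_caratheodory] leaves this many terms
   whatever [m N] is. *)
pose D := (p * q)%N.
have redQ N : exists fg : ('I_D -> 'rV[R]_p) * ('I_D -> 'rV[R]_q),
    [/\ forall k, dual_cone A (fg.1 k), forall k, dual_cone B (fg.2 k),
      Q N = \sum_k (fg.1 k)^T *m fg.2 k,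
      forall k i, fg.1 k 0 i <= 1 &
      forall k j, fg.2 k 0 j <= \sum_i Q N i j].
  (* The rank-one products, flattened to row vectors, are stable under nonnegative scaling. *)
  pose P := [set x | exists f g, [/\ dual_cone A f, dual_cone B g
    & x = mxvec (f^T *m g)]].
  have P0 : P 0.
    exists 0, 0; split; try exact: dual_cone0.
    by rewrite mulmx0 linear0.
  have PZ c y : 0 <= c -> P y -> P (c *: y).
    move=> c0 [f1 [g1 [h1 h2 ->]]]; exists (c *: f1), g1; split=> //.
      exact: dual_coneZ.
    by rewrite [(c *: f1)^T]linearZ /= -scalemxAl linearZ.
  have [|y [Py yE]] := @conic_caratheodory _ (m N) P
    (fun k => mxvec ((f N k)^T *m g N k)) P0 PZ.
    by move=> k; exists (f N k), (g N k).
  have {}Py k : exists fg : 'rV[R]_p * 'rV[R]_q,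
      [/\ dual_cone A fg.1, dual_cone B fg.2, fg.1^T *m fg.2 = vec_mx (y k),
        forall i, fg.1 0 i <= 1
      & forall j, fg.2 0 j <= \sum_i vec_mx (y k) i j].
    have [f1 [g1 [h1 h2 ->]]] := Py k; rewrite mxvecK.
    by have [f2 [g2 ?]] := rank1_normalize hA h1 h2; exists (f2, g2).
  have [fg hfg] := choice Py.
  exists (fst \o fg, snd \o fg) => /=.
  have QN : Q N = \sum_k (fg k).1^T *m (fg k).2.
    apply: (can_inj mxvecK); rewrite linear_sum yE linear_sum.
    apply: eq_bigr => k _ /=; have [_ _ -> _ _] := hfg k; by rewrite vec_mxK.
  split=> //; try by move=> k; case: (hfg k).
  move=> k j; have [_ _ e _ /(_ j)/le_trans] := hfg k; apply.
  (* All terms are entrywise nonnegative, so each one is dominated by the total [Q N]. *)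
  rewrite -e; apply: ler_sum => i _; rewrite QN summxE (bigD1 k) //= lerDl.
  apply: sumr_ge0 => l _; rewrite mxE big_ord1 mxE; have [a1 a2 _ _ _] := hfg l.
  by rewrite mulr_ge0 // (dual_cone_ge0 _ a1, dual_cone_ge0 _ a2).
have [fg hfg] := choice redQ.
(* One ultrafilter makes all the bounded coordinate sequences converge at once, in place of
   successive extractions of subsequences. *)
have [U [UU oU]] := ultraFilterLemma (_ : ProperFilter (\oo : set_system nat)).
have Qcv i j : (fun N => Q N i j) @ U --> M i j.
  apply: cvg_trans (cM i j); under eq_fun do rewrite QE.
  exact: cvg_app.
have cf k i : exists l, (fun N => (fg N).1 k 0 i) @ U --> (l : R).
  apply: (@ultra_bounded_cvg _ _ _ 0 1); apply: nearW => N.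
  by have [a1 _ _ -> _] := hfg N; rewrite (dual_cone_ge0 hA).
have cg k j : exists l, (fun N => (fg N).2 k 0 j) @ U --> (l : R).
  have cs : (fun N => \sum_i Q N i j) @ U --> \sum_i M i j.
    by apply: cvg_sumr => i; exact: Qcv.
  apply: (@ultra_bounded_cvg _ _ _ 0 (\sum_i M i j + 1)).
  have : \forall N \near U, \sum_i Q N i j <= \sum_i M i j + 1.
    apply: (cvgr_le _ cs); by rewrite ltrDl.
  apply: filterS => N le1; have [_ a2 _ _ /(_ k j) a4] := hfg N.
  by rewrite (dual_cone_ge0 hB) //= (le_trans a4).
have [lf lfE] := choice (fun ki : 'I_D * 'I_p => cf ki.1 ki.2).
have [lg lgE] := choice (fun kj : 'I_D * 'I_q => cg kj.1 kj.2).
exists D, (fun k => \row_i lf (k, i)), (fun k => \row_j lg (k, j)); split.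
- move=> k a Aa.
  have cv : (fun N => \sum_i a 0 i * (fg N).1 k 0 i) @ U -->
      \sum_i a 0 i * (\row_i lf (k, i)) 0 i.
    apply: cvg_sumr => i; rewrite mxE; apply: cvgMr; exact: (lfE (k, i)).
  apply: (closed_cvg (fun x : R => 0 <= x) _ _ _ cv); first exact: closed_ge.
  by apply: nearW => N; have [a1 _ _ _ _] := hfg N; exact: a1.
- move=> k a Aa.
  have cv : (fun N => \sum_i a 0 i * (fg N).2 k 0 i) @ U -->
      \sum_i a 0 i * (\row_i lg (k, i)) 0 i.
    apply: cvg_sumr => i; rewrite mxE; apply: cvgMr; exact: (lgE (k, i)).
  apply: (closed_cvg (fun x : R => 0 <= x) _ _ _ cv); first exact: closed_ge.
  by apply: nearW => N; have [_ a1 _ _ _] := hfg N; exact: a1.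
- apply/matrixP => i j; rewrite summxE.
  apply: (cvg_unique (@Rhausdorff R) (Qcv i j)).
  have -> : (fun N => Q N i j) =
      (fun N => \sum_k (fg N).1 k 0 i * (fg N).2 k 0 j).
    apply/funext => N; have [_ _ -> _ _] := hfg N; rewrite summxE.
    by apply: eq_bigr => k _; rewrite mxE big_ord1 mxE.
  apply: cvg_sumr => k; rewrite mxE big_ord1 !mxE.
  by apply: cvgM; [exact: (lfE (k, i))|exact: (lgE (k, j))].
Qed.

End ConicCaratheodory.

(** * Convergent series of operators and the counting measure *)

Section Series.
Context {R : realType}.

(** By Cauchy-Schwarz the error is at most [hsnorm x] times the norm of the error of the operator
    series. *)
Lemma hs_series_hsip n (x S : 'M[R[i]]_n) (E : nat -> 'M[R[i]]_n) :
  x \is hermsymmx -> S \is hermsymmx -> (forall k, E k \is hermsymmx) ->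
  hs_series_to E S -> series (fun k => hsip x (E k)) @ \oo --> hsip x S.
Proof.
move=> hx hS hE hES; apply/subr_cvg0/norm_cvg0P.
have cv : (fun N => hsnorm x * hsnorm (series E N - S)) @ \oo --> (0 : R).
  by rewrite -[X in _ --> X](mulr0 (hsnorm x)); apply: cvgMr.
apply: (squeeze_cvgr _ (cvg_cst 0) cv); apply: nearW => N.
rewrite normr_ge0 /=.
have -> : series (fun k => hsip x (E k)) N - hsip x S = hsip x (series E N - S).
  by rewrite /series /= hsipBr hsip_sumr.
by apply: hsip_CauchySchwarz => //; apply: hermB => //; apply: herm_sum.
Qed.

Lemma counting_finite_support (a : nat -> R) m :
  (forall k, 0 <= a k) -> (forall k, (m <= k)%N -> a k = 0) ->
  (counting : {measure set nat -> \bar R}).-integrable setT (fun k => (a k)%:E) /\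
  \int[counting]_k a k = \sum_(k < m) a k.
Proof.
move=> a0 am.
have aE : (\int[counting]_k (a k)%:E = (\sum_(k < m) a k)%:E)%E.
  rewrite ge0_integral_count => [|k]; last by rewrite lee_fin.
  rewrite (nneseries_split 0 m) => [|k _]; last by rewrite lee_fin.
  rewrite add0n eseries0 => [|k mk _]; last by rewrite am.
  by rewrite adde0 big_mkord sumEFin.
split; last by rewrite /Rintegral aE.
apply/integrableP; split; first by move=> _ Y _; rewrite setTI.
under eq_integral do rewrite gee0_abs ?lee_fin //.
by rewrite aE ltry.
Qed.

End Series.

(** * Geometry of the reduced space *)

Section ReducedSpace.
Context {R : realType} {n : nat} {s e : set 'M[R[i]]_n}.
Hypotheses (hs : state_space s) (he : effect_space e).

Let W := reduced_space s e.
Let pr := redproj s e.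
Let S := pr @` s.
Let T := pr @` e.

Lemma effect_herm x : e x -> x \is hermsymmx.
Proof. by case: he => _ h _ _ _ /h[[]]. Qed.

Let Y := orthproj (rspan e) @` s.

Let Ye x : Y x -> rspan e x.
Proof. by move=> [r _ <-]; have [] := orthprojP r effect_herm. Qed.

Let Yherm x : Y x -> x \is hermsymmx.
Proof. by move=> /Ye; exact/rspan_herm/effect_herm. Qed.

(** Linearity of the projection exhibits the reduced space as a span, the form required by the
    lemmas on [orthproj]. *)
Let WE : W = rspan Y.
Proof.
have lin m (c : 'I_m -> R) (v : 'I_m -> 'M[R[i]]_n) :
    orthproj (rspan e) (\sum_i (c i)%:C *: v i) =
    \sum_i (c i)%:C *: orthproj (rspan e) (v i).
  rewrite (big_morph _ (fun a b => orthprojD a b effect_herm) (orthproj0 effect_herm)).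
  by apply: eq_bigr => i _; rewrite orthprojZ //; exact: effect_herm.
apply/seteqP; split=> [_ [_ [m [c [v [hv ->]]]] <-]|x].
  by rewrite lin; apply: rspan_sum => i _; apply/rspanZ/sub_rspan; exists (v i).
move=> [m [c [v [hv ->]]]].
have [u hu] := choice (fun i => let: ex_intro2 r sr rE := hv i in
   ex_intro (fun r => s r /\ orthproj (rspan e) r = v i) r (conj sr rE)).
exists (\sum_i (c i)%:C *: u i).
  by exists m, c, u; split=> // i; case: (hu i).
by rewrite lin; apply: eq_bigr => i _; case: (hu i) => _ ->.
Qed.

Let prE : pr = orthproj (rspan Y).
Proof. by rewrite /pr /redproj -/W WE. Qed.

Lemma reduced_herm x : W x -> x \is hermsymmx.
Proof. by rewrite WE; exact: rspan_herm. Qed.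

Lemma redprojD x y : pr (x + y) = pr x + pr y.
Proof. by rewrite prE; exact: orthprojD. Qed.

Lemma redprojZ c x : pr (c%:C *: x) = c%:C *: pr x.
Proof. by rewrite prE; exact: orthprojZ. Qed.

Lemma redproj0 : pr 0 = 0.
Proof. by rewrite prE; exact: orthproj0. Qed.

Lemma redprojW x : W (pr x).
Proof. by rewrite WE prE; have [] := orthprojP x Yherm. Qed.

Lemma hsip_redprojl x y : W y -> hsip (pr x) y = hsip x y.
Proof. by rewrite WE prE; exact: hsip_orthprojl. Qed.

(** The projection of r onto the span of e already lies in W, and its residual is orthogonal to that
    span, which contains W. *)
Let pr_state r : s r -> pr r = orthproj (rspan e) r.
Proof.
move=> sr; rewrite prE; apply: orthproj_uniq => //.
  by apply: sub_rspan; exists r.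
move=> v hv; have [_] := orthprojP r effect_herm; apply.
by move: hv => [m [c [u [hu ->]]]]; apply: rspan_sum => i _; apply/rspanZ/Ye.
Qed.

Lemma hsip_redproj r E : s r -> e E -> hsip (pr r) (pr E) = hsip r E.
Proof.
move=> sr eE; rewrite hsipC hsip_redprojl; last exact: redprojW.
rewrite hsipC pr_state // hsip_orthprojl //; first exact: effect_herm.
exact: sub_rspan.
Qed.

Lemma rspan_states : rspan S = W.
Proof.
rewrite WE; congr rspan; apply/seteqP; split=> _ [r sr <-]; exists r => //.
  by rewrite pr_state.
by rewrite -/pr pr_state.
Qed.

(** For x in W, the residual of its projection onto the span of T lies in W and is orthogonal to the
    projected effects, hence to e. Since W is contained in the span of e, the residual is orthogonal
    to itself. *)
Lemma rspan_effects : rspan T = W.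
Proof.
have Therm x : T x -> x \is hermsymmx.
  by move=> [E _ <-]; apply/reduced_herm/redprojW.
have TW x : rspan T x -> W x.
  move=> [m [c [v [hv ->]]]]; rewrite WE; apply: rspan_sum => i _; apply: rspanZ.
  by rewrite -WE; have [E _ <-] := hv i; exact: redprojW.
apply/seteqP; split=> [x /TW //|x Wx].
have [sz oz] := orthprojP x Therm; set z := orthproj _ _ in sz oz.
suff /eqP : x - z = 0 by rewrite subr_eq0 => /eqP ->.
have Wxz : W (x - z).
  by have := TW _ sz; move: Wx; rewrite WE; exact: rspanB.
apply: hsip_eq0; first exact: reduced_herm.
apply: (@rspan_orth _ _ e) => [E eE|].
  rewrite hsipC -hsip_redprojl // hsipC; apply: oz.
  by apply: sub_rspan; exists E.
move: Wxz; rewrite WE => -[m [c [v [hv ->]]]].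
by apply: rspan_sum => i _; apply/rspanZ/Ye.
Qed.

Lemma redproj_convex (X : set 'M[R[i]]_n) : convex_set X ->
  forall (p : R) x y, 0 <= p <= 1 -> (pr @` X) x -> (pr @` X) y ->
  (pr @` X) (p%:C *: x + (1 - p)%:C *: y).
Proof.
move=> /convex_setP cX p _ _ p01 [x Xx <-] [y Xy <-].
exists (p%:C *: x + (1 - p)%:C *: y); first exact: cX.
by rewrite redprojD !redprojZ.
Qed.

(** The unit trace survives the projection, so S lies in an affine hyperplane missing the origin;
    coordinates of states in a basis of states therefore sum to 1. *)
Lemma hsip_state_one r : S r -> hsip r (pr 1%:M) = 1.
Proof.
move=> [rho sr <-]; have [_ _ _ e1 _] := he; rewrite hsip_redproj //.
by have [_ _ /(_ _ sr)[_ tr1]] := hs; rewrite /hsip mulmx1 tr1.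
Qed.

(** The complement of an effect is a finite or countable sum of elements of e, each pairing
    nonnegatively with x; in the countable case nonnegativity passes to the limit. *)
Lemma polar_effect_le x E : polar_cone W T x -> T E -> hsip x E <= hsip x (pr 1%:M).
Proof.
move=> [Wx x0] [E0 eE <-].
have pos F : e F -> 0 <= hsip x F.
  by move=> eF; rewrite hsipC -hsip_redprojl //; apply: x0; exists F.
rewrite !(hsipC x) !hsip_redprojl // -!(hsipC x) -subr_ge0 -hsipBr.
have [_ _ _ e1 /(_ _ eE)[[K [F [eF EF]]]|[F [eF EF]]]] := he.
  rewrite -EF addrC addKr hsip_sumr sumr_ge0 // => k _; exact: pos.
have cv := hs_series_hsip (reduced_herm Wx)
  (hermB (effect_herm e1) (effect_herm eE)) (fun k => effect_herm (eF k)) EF.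
apply: (closed_cvg (fun y : R => 0 <= y) _ _ _ cv); first exact: closed_ge.
by apply: nearW => N; apply: sumr_ge0 => k _; exact: pos.
Qed.

End ReducedSpace.

(** * From a Riemann integrable model to separability *)

Section ModelToSep.
Context {R : realType} {n : nat} {s e : set 'M[R[i]]_n}.
Hypotheses (hs : state_space s) (he : effect_space e).

Let W := reduced_space s e.
Let S := redproj s e @` s.
Let T := redproj s e @` e.

(** Uniform weights [D.+1%:R^-1] are compensated by scaling each F, which stays in its cone. The
    additional zero term keeps the convex combination nonempty when D is 0. *)
Lemma sep_sum D (F G : 'I_D -> 'M[R[i]]_n) :
  (forall k, polar_cone W S (F k)) -> (forall k, polar_cone W T (G k)) ->
  Sep s e (\sum_k F k *t G k).
Proof.
move=> hF hG.
have WE : W = rspan S by rewrite (rspan_states he).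
have W0 : W 0 by rewrite WE; exact: rspan0.
have t0 : (D.+1%:R : R) != 0 by rewrite pnatr_eq0.
exists D.+1, (fun=> D.+1%:R^-1), (fun i => oapp
  (fun k => (D.+1%:R%:C *: F k) *t G k) (0 *t 0) (unlift ord0 i)); split.
- by move=> _; rewrite invr_ge0 ler0n.
- by rewrite sumr_const card_ord -[LHS]mulr_natl mulfV.
- move=> i; case: (unlift _ _) => [k|] /=; last first.
    exists 0; first by split=> // x _; rewrite hsip0r.
    by exists 0 => //; split=> // x _; rewrite hsip0r.
  exists (D.+1%:R%:C *: F k); last by exists (G k).
  have [WF F0] := hF k; split; first by move: WF; rewrite /= -/W WE; exact: rspanZ.
  by move=> x Sx; rewrite hsipZr mulr_ge0 ?ler0n ?F0.
- rewrite big_ord_recl unlift_none /= tens0mx scaler0 add0r.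
  apply: eq_bigr => k _; rewrite liftK /= tensmxZl scalerA -rmorphM mulVf //.
  by rewrite rmorph1 scale1r.
Qed.

Section Functionals.
Variables (X : set 'M[R[i]]_n) (m : nat) (v w : nat -> 'M[R[i]]_n).
Hypothesis db : dual_bases X m v w.

(** Pairing with [w i] gives the coordinate along [v i], so these are the coordinate vectors of the
    points of X, and the [v i] become the unit vectors. *)
Definition coord_cone : set 'rV[R]_m :=
  [set a | exists2 x, X x & a = \row_i hsip x (w i)].

Lemma coord_cone_delta i : coord_cone (delta_mx 0 i).
Proof.
have [hv _ vw _] := db; exists (v i); first exact: hv.
by apply/rowP => j; rewrite !mxE vw // eqxx eq_sym.
Qed.

Lemma polar_of_dual_cone f : dual_cone coord_cone f ->
  polar_cone (rspan X) X (\sum_i (f 0 i)%:C *: w i).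
Proof.
have [_ hw _ _] := db; move=> hf; split.
  by apply: rspan_sum => i _; apply/rspanZ/hw.
move=> x Xx; have := hf _ (ex_intro2 _ _ x Xx erefl); rewrite hsip_sumr.
by congr (0 <= _); apply: eq_bigr => i _; rewrite mxE hsipZr mulrC.
Qed.

Lemma hsip_coord (f : 'rV[R]_m) x :
  hsip (\sum_i (f 0 i)%:C *: w i) x = ((\row_i hsip x (w i)) *m f^T) 0 0.
Proof.
rewrite hsip_suml mxE; apply: eq_bigr => i _.
by rewrite !mxE hsipZl hsipC mulrC.
Qed.

Lemma dual_cone_functional (g : 'M[R[i]]_n -> R) :
  (forall x, X x -> 0 <= g x) ->
  (forall x, X x -> g x = \sum_(i < m) hsip x (w i) * g (v i)) ->
  dual_cone coord_cone (\row_i g (v i)).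
Proof.
move=> g0 gE _ [x Xx ->]; rewrite -[X in 0 <= X](_ : g x = _); first exact: g0.
by rewrite gE //; apply: eq_bigr => i _; rewrite !mxE.
Qed.

End Functionals.

Lemma model_sep d (L : measurableType d) (nu : {measure set L -> \bar R})
    (mu xi : 'M[R[i]]_n -> L -> R) :
  noncontextual_model s e nu mu xi -> riemann_integrable s e nu mu xi ->
  Sep s e (choi W id).
Proof.
move=> [_ _ mu0 muC xiF _ xi0 xiC _ born] [Delta [ldis [D0 cv]]].
have [_ sC _] := hs; have [eC _ e0 e1 _] := he.
have WS : W = rspan S by rewrite (rspan_states he).
have WT : W = rspan T by rewrite (rspan_effects he).
have Wh x : W x -> x \is hermsymmx by exact: reduced_herm he x.
have Sh x : S x -> x \is hermsymmx.
  by move=> Sx; apply: Wh; rewrite WS; exact: sub_rspan.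
have Th x : T x -> x \is hermsymmx.
  by move=> Tx; apply: Wh; rewrite WT; exact: sub_rspan.
have T0 : T 0 by exists 0 => //; exact: redproj0 he.
(* Compare the normalization of the one-outcome measurement 1 with that of the two-outcome
   measurement 1, 0. *)
have xi00 l : xi 0 l = 0.
  have xi1 : xi (redproj s e 1%:M) l = 1.
    by have := xiF l 1 (fun=> 1%:M); rewrite !big_ord1; apply.
  have := xiF l 2 (fun i => if i == ord0 then 1%:M else 0).
  rewrite !big_ord_recl !big_ord0 !addr0 /= (redproj0 he) xi1 => h.
  by apply: (addrI 1); rewrite addr0 h // => k; case: ifP.
have [p [r [r' dbS]]] := dual_bases_exist Sh.
have [q [E [E' dbT]]] := dual_bases_exist Th.
have [hr hr' _ exS] := dbS; have [hE hE' _ exT] := dbT.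
have muL l x : S x -> mu x l = \sum_(i < p) hsip x (r' i) * mu (r i) l.
  move=> Sx; have xE := exS x (sub_rspan Sx).
  apply: (@affine_comb _ _ S (fun y => mu y l) _ _ p (fun i => hsip x (r' i)) r) => //.
  - exact: redproj_convex he _ _.
  - by move=> *; exact: muC.
  - rewrite -(hsip_state_one hs he Sx) {2}xE hsip_suml; apply: eq_bigr => i _.
    by rewrite hsipZl (hsip_state_one hs he) ?mulr1 //; exact: hr.
have xiL l x : T x -> xi x l = \sum_(i < q) hsip x (E' i) * xi (E i) l.
  move=> Tx; have xE := exT x (sub_rspan Tx).
  apply: (@affine_lincomb _ _ T (fun y => xi y l) _ _ q (fun i => hsip x (E' i)) E) => //.
  - exact: redproj_convex he _ _.
  - by move=> *; exact: xiC.
(* The weight [Delta] is absorbed into f; the shift [k.+1] matches Riemann sums that start at 1 with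
   ordinals that start at 0. *)
pose f N k := Delta N k.+1 *: \row_(i < p) mu (r i) (ldis N k.+1).
pose g N k := \row_(j < q) xi (E j) (ldis N k.+1).
have [||N k|N k|i j|D [f' [g' [hf hg ME]]]] := @rank1_sums_closed R p q
  (coord_cone S r') (coord_cone T E') id f g (\matrix_(i, j) hsip (r i) (E j)).
- exact: coord_cone_delta dbS.
- exact: coord_cone_delta dbT.
- apply: dual_coneZ => //.
  apply: (dual_cone_functional (g := fun x => mu x _)) => x Sx; [exact: mu0|exact: muL].
- apply: (dual_cone_functional (g := fun x => xi x _)) => x Tx; [exact: xi0|exact: xiL].
- rewrite mxE born; [|exact: hr|exact: hE].
  have -> : (fun N => \sum_(k < id N) f N k 0 i * g N k 0 j) =
      (fun N => \sum_(1 <= k < N.+1)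
        Delta N k * mu (r i) (ldis N k) * xi (E j) (ldis N k)).
    apply/funext => N; rewrite big_add1 big_mkord.
    by apply: eq_bigr => k _; rewrite !mxE.
  by apply: cv; [exact: hr|exact: hE].
pose F k := \sum_i (f' k 0 i)%:C *: r' i.
pose G k := \sum_j (g' k 0 j)%:C *: E' j.
have pF k : polar_cone W S (F k) by rewrite WS; exact: (polar_of_dual_cone dbS (hf k)).
have pG k : polar_cone W T (G k) by rewrite WT; exact: (polar_of_dual_cone dbT (hg k)).
rewrite (@choi_idE _ _ _ (\sum_k F k *t G k)) //; first exact: sep_sum.
  apply: rspan_sum => k _; apply: sub_rspan; exists (F k); first by case: (pF k).
  by exists (G k) => //; case: (pG k).
move=> x y Wx Wy; rewrite hsip_suml.
pose a := \row_(i < p) hsip x (r' i); pose b := \row_(j < q) hsip y (E' j).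
(* Expanding x in projected states and y in projected effects reduces the inner product to the
   matrix that [rank1_sums_closed] has decomposed. *)
have -> : hsip x y = (a *m (\matrix_(i, j) hsip (r i) (E j)) *m b^T) 0 0.
  have {1}-> := exS x; last by rewrite -WS.
  have {1}-> := exT y; last by rewrite -WT.
  rewrite hsip_sumr mxE; apply: eq_bigr => j _; rewrite hsipZr !mxE mulrC.
  by congr (_ * _); rewrite hsip_suml; apply: eq_bigr => i _; rewrite hsipZl !mxE.
rewrite ME mulmx_sumr mulmx_suml summxE; apply: eq_bigr => k _.
have [WF _] := pF k; have [WG _] := pG k.
rewrite hsip_tens ?Wh // !hsip_coord -/a -/b mulmxA -mulmxA.
have -> : g' k *m b^T = (b *m (g' k)^T)^T by rewrite trmx_mul trmxK.
by rewrite [LHS]mxE big_ord1 [(_^T) 0 0]mxE.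
Qed.

End ModelToSep.

(** * From separability to a discrete model *)

Section SepToModel.
Context {R : realType} {n : nat} {s e : set 'M[R[i]]_n}.
Hypotheses (hs : state_space s) (he : effect_space e).

Let W := reduced_space s e.
Let S := redproj s e @` s.
Let T := redproj s e @` e.
Let one := redproj s e 1%:M.

Lemma sep_model : Sep s e (choi W id) ->
  exists mu xi : 'M[R[i]]_n -> nat -> R,
    noncontextual_model s e (counting : {measure set nat -> \bar R}) mu xi /\
    riemann_integrable s e (counting : {measure set nat -> \bar R}) mu xi.
Proof.
have [eC _ e0 e1 _] := he; have [[rho0 srho0] sC _] := hs.
have WS : W = rspan S by rewrite (rspan_states he).
have Wh x : W x -> x \is hermsymmx := reduced_herm he (x := x).
have SW x : S x -> W x by rewrite WS; exact: sub_rspan.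
have TW x : T x -> W x by rewrite /W -(rspan_effects he); exact: sub_rspan.
have Tone : T one by exists 1%:M.
move=> [m [p [v [p0 _ hv cE]]]].
have FG i : exists fg : 'M[R[i]]_n * 'M[R[i]]_n,
    [/\ polar_cone W S fg.1, polar_cone W T fg.2 & v i = fg.1 *t fg.2].
  by have [F PF [G PG <-]] := hv i; exists (F, G).
have [fg hfg] := choice FG.
pose F i := (fg i).1; pose G i := (fg i).2.
have pF i : polar_cone W S (F i) by case: (hfg i).
have pG i : polar_cone W T (G i) by case: (hfg i).
have WF i : W (F i) by case: (pF i).
have WG i : W (G i) by case: (pG i).
have F0 i x : S x -> 0 <= hsip (F i) x by rewrite hsipC; case: (pF i) => _; apply.
have G0 i x : T x -> 0 <= hsip (G i) x by rewrite hsipC; case: (pG i) => _; apply.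
have pair x y : W x -> W y ->
    hsip x y = \sum_i p i * (hsip (F i) x * hsip (G i) y).
  move=> Wx Wy.
  have -> : hsip x y = hsip (choi W id) (x *t y).
    by rewrite WS -choi_idP -?WS // => z /SW /Wh.
  rewrite cE hsip_suml; apply: eq_bigr => i _; have [_ _ ->] := hfg i.
  by rewrite hsipZl (hsip_tens (Wh _ (WF i)) (Wh _ (WG i)) (Wh _ Wx) (Wh _ Wy)).
(* Pairings with effects lie between 0 and the pairing with [one], so a functional vanishing there
   vanishes on all of T. *)
have G_null i x : hsip (G i) one = 0 -> T x -> hsip (G i) x = 0.
  move=> z Tx; apply/eqP; rewrite eq_le G0 // andbT -z.
  exact: (polar_effect_le he).
(* Otherwise [pair] would make a projected state pair to 0 with [one], instead of 1. *)
have [i0 i0n] : exists i, hsip (G i) one != 0.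
  apply: contrapT => /forallNP nz.
  have Srho : S (redproj s e rho0) by exists rho0.
  have := hsip_state_one hs he Srho; rewrite -/one pair; [|exact: SW|exact: TW].
  rewrite big1 => [/esym/eqP|i _]; first by rewrite oner_eq0.
  by have /negP := nz i; rewrite negbK => /eqP ->; rewrite !mulr0.
pose ng i := (hsip (G i) one)^-1%:C *: G i.
(* Ontic states whose response functional vanishes carry no weight; they are
   given an arbitrary normalized response. *)
pose sg l := oapp (fun i => if hsip (G i) one == 0 then ng i0 else ng i)
  (ng i0) (insub l : option 'I_m).
have sgP l : exists2 i, hsip (G i) one != 0 & sg l = ng i.
  rewrite /sg; case: insub => [i|] /=; last by exists i0.
  by case: eqVneq => [_|z]; [exists i0|exists i].
have Wsg l : W (sg l).
  have [i _ ->] := sgP l; have := WG i; rewrite WS; exact: rspanZ.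
have sg0 l x : T x -> 0 <= hsip (sg l) x.
  move=> Tx; have [i _ ->] := sgP l.
  by rewrite hsipZl mulr_ge0 ?invr_ge0 ?G0.
have sg1 l : hsip (sg l) 1%:M = 1.
  rewrite hsipC -(hsip_redprojl he 1%:M (Wsg l)) hsipC; have [i z ->] := sgP l.
  by rewrite hsipZl mulVf.
have sg_red l x : hsip (sg l) (redproj s e x) = hsip (sg l) x.
  by rewrite hsipC (hsip_redprojl he x (Wsg l)) hsipC.
(* The ontic space is all of [nat] with counting measure; states from m on have weight 0. *)
pose mu x l := oapp (fun i => p i * hsip (F i) x * hsip (G i) one) 0
  (insub l : option 'I_m).
pose xi x l := hsip (sg l) x.
have mu_ge0 x l : S x -> 0 <= mu x l.
  move=> Sx; rewrite /mu; case: insub => [i|] //=.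
  by rewrite !mulr_ge0 ?p0 ?F0 ?G0.
have mu_out x l : (m <= l)%N -> mu x l = 0.
  by move=> ml; rewrite /mu insubN // -leqNgt.
have mu_in x (i : 'I_m) : mu x i = p i * hsip (F i) x * hsip (G i) one.
  by rewrite /mu (valK i).
have muxi x y (i : 'I_m) : T y ->
    mu x i * xi y i = p i * (hsip (F i) x * hsip (G i) y).
  (* At a null index both sides vanish by [G_null]; elsewhere the normalizing factors of mu and xi
     cancel. *)
  move=> Ty; rewrite mu_in /xi /sg (valK i) /=; case: eqVneq => [z|z].
    by rewrite z mulr0 mul0r (G_null i y z Ty) !mulr0.
  by rewrite hsipZl -!mulrA mulVKf.
have muxi_ge0 x y l : S x -> T y -> 0 <= mu x l * xi y l.
  by move=> Sx Ty; rewrite mulr_ge0 ?mu_ge0 ?sg0.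
have muxi_out x y l : (m <= l)%N -> mu x l * xi y l = 0.
  by move=> ml; rewrite mu_out // mul0r.
have int_mu x : S x -> _ := fun Sx => counting_finite_support
  (fun l => mu_ge0 x l Sx) (mu_out x).
have int_muxi x y : S x -> T y -> _ := fun Sx Ty => counting_finite_support
  (fun l => muxi_ge0 x y l Sx Ty) (muxi_out x y).
have born x y : S x -> T y -> \sum_(i < m) mu x i * xi y i = hsip x y.
  move=> Sx Ty; rewrite pair; [|exact: SW|exact: TW].
  by apply: eq_bigr => i _; rewrite muxi.
exists mu, xi; split; first split.
- by move=> x Sx; case: (int_mu x Sx).
- move=> x Sx; rewrite (int_mu x Sx).2 -(hsip_state_one hs he Sx) -/one.
  rewrite pair; [|exact: SW|exact: TW].
  by apply: eq_bigr => i _; rewrite mu_in mulrA.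
- by move=> x l; exact: mu_ge0.
- move=> l t x y _ _ _; rewrite /mu; case: insub => [i|] /=; last by rewrite !mulr0 addr0.
  by rewrite hsipDr !hsipZr; ring.
- move=> l K E eE E1; under eq_bigr do rewrite /xi sg_red.
  by rewrite -hsip_sumr E1.
- move=> l E eE E1; rewrite -(sg1 l); under eq_fun do rewrite /xi sg_red.
  by apply: hs_series_hsip => //; [exact: Wh|exact: effect_herm he _ _|
    move=> k; exact: effect_herm he _ _].
- by move=> x l; exact: sg0.
- by move=> l t x y _ _ _; rewrite /xi hsipDr !hsipZr.
- by move=> x y Sx Ty; case: (int_muxi x y Sx Ty).
- by move=> x y Sx Ty; rewrite (int_muxi x y Sx Ty).2 born.
(* Unit weights at the points 0, ..., N - 1: once N reaches m, the Riemann sum equals the integral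
   exactly. *)
exists (fun _ _ => 1), (fun _ k => k.-1); split=> // x y Sx Ty.
rewrite (int_muxi x y Sx Ty).2; apply: cvg_near_cst.
exists m => // N /= mN; rewrite big_add1 big_mkord.
rewrite -(big_mkord xpredT (fun k => 1 * mu x k * xi y k)).
rewrite (big_cat_nat _ mN) //= [X in _ + X]big_nat_cond [X in _ + X]big1.
  by rewrite addr0 big_mkord; apply: eq_bigr => i _; rewrite mul1r.
by move=> k /andP[/andP[mk _] _]; rewrite mul1r muxi_out.
Qed.

End SepToModel.

Theorem theorem2 (R : realType) (n : nat) (s e : set 'M[R[i]]_n)
    (hs : state_space s) (he : effect_space e) :
  (exists (d : measure_display) (L : measurableType d)
      (nu : {measure set L -> \bar R}) (mu xi : 'M[R[i]]_n -> L -> R),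
      noncontextual_model s e nu mu xi /\ riemann_integrable s e nu mu xi) <->
  Sep s e (choi (reduced_space s e) id).
Proof.
split=> [[d [L [nu [mu [xi [model rint]]]]]]|sep].
  exact: (model_sep hs he model rint).
have [mu [xi model]] := sep_model hs he sep.
by exists _, nat, counting, mu, xi.
Qed.
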